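(* Let $f$ be a random completely multiplicative function (defined below). There exist constants $C>0$, $C'>0$ and $x_0$ such that for all real $x\ge x_0$, $$\mathbb P\left(\sum_{n\le x}\frac{f(n)}{n}>0\right)\ \ge\ 1- C'\exp\left(-\exp\left(\frac{\log x}{C\log\log x}\right)\right).$$
   Context: A random completely multiplicative function $f$ is defined by choosing the values $f(p)\in\{1,-1\}$ at primes $p$ independently, each with probability $\tfrac12$, and extending completely multiplicatively to all positive integers: $f(1)=1$ and $f(mn)=f(m)f(n)$ for all $m,n\ge1$. *)

(* Defs.v *)
From HB Require Import structures.
From mathcomp Require Import all_boot all_order all_algebra.
From mathcomp Require Import all_classical all_reals all_analysis.
Set Implicit Arguments.
Unset Strict Implicit.
Unset Printing Implicit Defensive.
Import Order.TTheory GRing.Theory Num.Theory.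
Import numFieldNormedType.Exports.
Local Open Scope classical_set_scope.
Local Open Scope ring_scope.

Definition mutually_independent (R : realType) (d : measure_display)
    (T : measurableType d) (P : probability T R) (I : choiceType)
    (A : set I) (X : I -> {RV P >-> R}) : Prop :=
  forall (s : seq I) (B : I -> set R),
    uniq s -> [set` s] `<=` A -> (forall i, measurable (B i)) ->
    P (\bigcap_(i in [set` s]) (X i @^-1` B i)) =
    (\prod_(i <- s) P (X i @^-1` B i))%E.

(* The value [f 0] is irrelevant: only positive arguments are constrained. *)
Record random_completely_multiplicative (R : realType) (d : measure_display)
    (T : measurableType d) (P : probability T R)
    (f : nat -> {RV P >-> R}) : Prop := {
  rcm_prime : forall p w, prime p -> f p w = 1 \/ f p w = -1;
  rcm_prob1 : forall p, prime p -> P [set w | f p w = 1] = (2^-1)%:E;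
  rcm_probN1 : forall p, prime p -> P [set w | f p w = -1] = (2^-1)%:E;
  rcm_indep : mutually_independent [set p | prime p] f;
  rcm_one : forall w, f 1%N w = 1;
  rcm_mul : forall m n w, (0 < m)%N -> (0 < n)%N ->
    f (m * n)%N w = f m w * f n w
}.

(* Main.v *)
Require Import Defs.
From HB Require Import structures.
From mathcomp Require Import all_boot all_order all_algebra.
From mathcomp Require Import all_classical all_reals all_analysis.
From mathcomp Require Import ring lra.
Import Order.TTheory GRing.Theory Num.Theory.
Import numFieldNormedType.Exports.
Local Open Scope classical_set_scope.
Local Open Scope ring_scope.

(* Fix y = x^(1 / (40 log log x)) and sort the integers n <= x by their largest
   prime factor.  The y-smooth ones contribute the Euler product over p <= y,
   which is at least c / (log x)^2 for every choice of signs, up to a tail that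
   Rankin's trick bounds by a large negative power of log x.  The integers with
   largest prime factor p > y contribute f(p) * A_p / p + O(log x / p^2), where
   A_p depends only on the signs of the primes below p and |A_p| = O(log x).
   The first terms are the increments of a martingale whose total squared size
   is O((log x)^2 / y), so by Azuma's inequality it reaches -c / (log x)^2 with
   probability at most exp(- y / (log x)^O(1)). *)

(** * Smooth numbers and the sums over them *)

Definition smooth (i n : nat) : bool := all (fun p => p <= i)%N (primes n).

(** The cutoff is a natural number, so that dividing out a prime [p] turns [N] into [N %/ p] and
    recursions stay within the same family. *)
Definition smooth_sum {R : realType} (g : nat -> R) (i N : nat) : R :=
  \sum_(1 <= n < N.+1 | smooth i n) g n / n%:R.

Lemma smooth_ge i n : (n <= i)%N -> smooth i n.
Proof.
move=> le_ni; apply/allP => p; rewrite mem_primes => /and3P[_ n0 /(dvdn_leq n0)].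
by move=> /leq_trans; apply.
Qed.

Lemma smooth0 n : (0 < n)%N -> smooth 0 n = (n == 1%N).
Proof.
move=> n0; apply/allP/eqP => [h|-> //].
apply/eqP; rewrite eqn_leq n0 andbT leqNgt; apply/negP => n1.
have := h (pdiv n); rewrite mem_primes pdiv_prime// n0 pdiv_dvd => /(_ isT).
by rewrite /= leqn0 => /eqP p0; have := pdiv_gt0 n; rewrite p0.
Qed.

Lemma smoothS_ndvd i n : ~~ [&& prime i.+1 & (i.+1 %| n)%N] ->
  smooth i.+1 n = smooth i n.
Proof.
move=> h; apply: eq_in_all => p; rewrite mem_primes => /and3P[pp n0 pn].
rewrite leq_eqVlt ltnS; case: eqP => //= pE.
by move: h; rewrite -pE pp pn.
Qed.

Lemma smoothM i p m : prime p -> (p <= i)%N -> (0 < m)%N ->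
  smooth i (p * m) = smooth i m.
Proof.
move=> pp le_pi m0; have p0 := prime_gt0 pp.
apply/allP/allP => h q => [qm|].
  by apply: h; rewrite primesM// qm orbT.
by rewrite primesM// (primes_prime pp) inE => /orP[/eqP -> //|]; apply: h.
Qed.

Lemma smooth_dvdF i n : (0 < n)%N -> prime i.+1 -> (i.+1 %| n)%N -> smooth i n = false.
Proof.
move=> n0 pi dn; apply/negP => /allP/(_ i.+1); rewrite mem_primes pi n0 dn => /(_ isT).
by rewrite /= ltnn.
Qed.

Lemma sum_dvd {R : realType} (F : nat -> R) (p N : nat) : (0 < p)%N ->
  \sum_(1 <= n < N.+1 | (p %| n)%N) F n = \sum_(1 <= m < (N %/ p).+1) F (p * m)%N.
Proof.
move=> p0; elim: N => [|N IH]; first by rewrite div0n big_mkcond !big_geq.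
rewrite big_mkcond big_nat_recr//= -big_mkcond IH divnS//.
case: ifP => [pN|pN]; last by rewrite addr0 add0n.
rewrite add1n [in RHS]big_nat_recr//=; congr (_ + F _).
by have := divnS N p0; rewrite pN add1n => <-; rewrite mulnC divnK.
Qed.

(** * Recursion in the largest prime and comparison with the Euler product *)

Section CompletelyMultiplicative.
Context {R : realType} (g : nat -> R).
Hypothesis g1 : g 1%N = 1.
Hypothesis gM : forall m n, (0 < m)%N -> (0 < n)%N -> g (m * n)%N = g m * g n.
Hypothesis gp : forall p, prime p -> g p = 1 \/ g p = -1.

Lemma cmult_norm n : (0 < n)%N -> `|g n| = 1.
Proof.
elim/ltn_ind: n => n IH n0; case: (ltnP 1 n) => [n1|]; last first.
  by case: n n0 {IH} => [|[|//]] // _ _; rewrite g1 normr1.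
have pp := pdiv_prime n1; have := pdiv_dvd n => /dvdnP[k kE].
have k0 : (0 < k)%N by case: k kE => // kE; rewrite kE in n0.
rewrite kE gM ?pdiv_gt0// normrM IH//; last first.
  by rewrite [ltnRHS]kE ltn_Pmulr// prime_gt1.
by case: (gp _ pp) => ->; rewrite ?normrN normr1 mulr1.
Qed.

(** Split by divisibility by [p = i.+1]: the multiples are [p * m] with [m <= N %/ p], and [m] may
    contain [p] again, whence [i.+1] in the last sum. *)
Lemma smooth_sumS i N : prime i.+1 ->
  smooth_sum g i.+1 N = smooth_sum g i N +
    g i.+1 / i.+1%:R * smooth_sum g i.+1 (N %/ i.+1).
Proof.
move=> pi; rewrite /smooth_sum (bigID (fun n => i.+1 %| n)%N)/= addrC; congr (_ + _).
  rewrite [RHS]big_mkcond [LHS]big_mkcond !big_nat; apply: eq_bigr => n /andP[n0 _].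
  case: (boolP (i.+1 %| n)%N) => dn; rewrite ?andbF ?andbT.
    by rewrite smooth_dvdF.
  by rewrite smoothS_ndvd// negb_and dn orbT.
under eq_bigl do rewrite andbC.
rewrite big_mkcondr sum_dvd// [in RHS]big_mkcond /= mulr_sumr !big_nat.
apply: eq_bigr => m /andP[m0 _]; rewrite smoothM//.
case: ifP => _; last by rewrite mulr0.
by rewrite gM// natrM invfM mulrACA.
Qed.

Lemma smooth_sumS_nprime i N : ~~ prime i.+1 -> smooth_sum g i.+1 N = smooth_sum g i N.
Proof.
by move=> pi; apply: eq_bigl => n; rewrite smoothS_ndvd// negb_and pi.
Qed.

Lemma smooth_sum_top N : smooth_sum g N N = \sum_(1 <= n < N.+1) g n / n%:R.
Proof.
rewrite /smooth_sum big_mkcond !big_nat; apply: eq_bigr => n /andP[_ nN].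
by rewrite smooth_ge.
Qed.

Lemma smooth_sum_at0 i : smooth_sum g i 0 = 0.
Proof. by rewrite /smooth_sum big_mkcond big_geq. Qed.

Lemma smooth_sum0 N : (0 < N)%N -> smooth_sum g 0 N = 1.
Proof.
move=> N0; rewrite /smooth_sum big_mkcond big_nat.
under eq_bigr => n /andP[n0 _] do rewrite smooth0//.
by rewrite -big_nat big_ltn//= g1 divr1 big_nat big1 ?addr0// => -[|[|n]].
Qed.

Lemma norm_smooth_sum_le i N : `|smooth_sum g i N| <= \sum_(1 <= n < N.+1) n%:R^-1.
Proof.
apply: (le_trans (ler_norm_sum _ _ _)); rewrite big_mkcond !big_nat.
apply: ler_sum => n /andP[n0 _].
by case: ifP => _; rewrite ?invr_ge0// normrM cmult_norm// mul1r ger0_norm ?invr_ge0.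
Qed.

(** Two rounds of [smooth_sumS], with [g p ^+ 2 = 1]. In the linear term the coefficient of [g p]
    now depends only on primes below [p], as a martingale increment requires; the rest carries a
    factor [1 / p^2]. *)
Lemma smooth_sum_split i N : prime i.+1 ->
  smooth_sum g i.+1 N = smooth_sum g i N +
    g i.+1 / i.+1%:R * smooth_sum g i (N %/ i.+1) +
    (i.+1%:R ^+ 2)^-1 * smooth_sum g i.+1 (N %/ i.+1 %/ i.+1).
Proof.
move=> pi; rewrite smooth_sumS// (smooth_sumS _ (N %/ _))// mulrDr addrA mulrA.
congr (_ + _ * _); rewrite mulrACA.
by case: (gp _ pi) => ->; rewrite ?mulrNN mulr1 mul1r expr2 invfM.
Qed.

(* Rankin's trick; the strong induction on [N] replaces the infinite series
   over smooth numbers by the functional equation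
   [A_p(N) = A_(p-1)(N) + g p / p * A_p(N / p)], also satisfied (with no
   dependence on [N]) by the Euler product. *)
Lemma smooth_sum_euler (s : R) (i N : nat) : 0 < s ->
  (forall p, prime p -> (p <= i)%N -> p%:R `^ s / p%:R < 1) ->
  `|smooth_sum g i N - \prod_(1 <= p < i.+1 | prime p) (1 - g p / p%:R)^-1|
  <= N.+1%:R `^ (- s) *
     \prod_(1 <= p < i.+1 | prime p) (1 - p%:R `^ s / p%:R)^-1.
Proof.
move=> s0; elim/ltn_ind: N i => N IHN i; elim: i => [|i IHi] hs.
  rewrite !big_mkcond !big_geq// mulr1; case: (posnP N) => [->|N0].
    by rewrite smooth_sum_at0 sub0r normrN normr1 powR1.
  by rewrite smooth_sum0// subrr normr0 powR_ge0.
have hs' : forall p, prime p -> (p <= i)%N -> p%:R `^ s / p%:R < 1.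
  by move=> p pp pi; apply: hs => //; apply: leqW.
have {}IHi := IHi hs'.
case: (boolP (prime i.+1)) => pi; last first.
  rewrite smooth_sumS_nprime// big_mkcond big_nat_recr//= (negbTE pi) mulr1 -big_mkcond.
  by rewrite [X in _ <= _ * X]big_mkcond big_nat_recr//= (negbTE pi) mulr1 -big_mkcond.
set F := \prod_(1 <= p < i.+2 | prime p) (1 - g p / p%:R)^-1.
set G := \prod_(1 <= p < i.+2 | prime p) (1 - p%:R `^ s / p%:R)^-1.
move: IHi; set F' := \prod_(1 <= p < i.+1 | prime p) (1 - g p / p%:R)^-1.
set G' := \prod_(1 <= p < i.+1 | prime p) (1 - p%:R `^ s / p%:R)^-1 => IHi.
set q : R := i.+1%:R; have q1 : 1 < q by rewrite ltr1n prime_gt1.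
have q0 : 0 < q by apply: lt_trans q1.
set w := q `^ s / q; have w1 : w < 1 by apply: hs.
have w0 : q^-1 <= w.
  by rewrite ler_pdivlMr// mulVf ?gt_eqF// -(powRr0 q) ler_powR// ltW.
have FE : F = F' + g i.+1 / q * F.
  have -> : F = F' * (1 - g i.+1 / q)^-1.
    by rewrite /F big_mkcond big_nat_recr//= pi -big_mkcond.
  have nz : 1 - g i.+1 / q != 0.
    rewrite subr_eq0 eq_sym; apply/eqP => h; have := cmult_norm i.+1 isT.
    have -> : g i.+1 = q by rewrite -[LHS](divfK (lt0r_neq0 q0)) h mul1r.
    by rewrite gtr0_norm// => qE; move: q1; rewrite qE ltxx.
  by rewrite -{2}(divfK nz F') mulrBr mulr1 [_ * (g _ / _)]mulrC subrK.
(* The identity [G' + w * G = G] is what closes the induction with no loss. *)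
have GE : G' = G * (1 - w).
  rewrite /G big_mkcond big_nat_recr//= pi -big_mkcond -mulrA mulVf ?mulr1//.
  by rewrite subr_eq0 gt_eqF.
have G0 : 0 <= G.
  rewrite /G big_nat_cond; apply: prodr_ge0 => p /andP[/andP[_ pi1] pp].
  by rewrite invr_ge0 subr_ge0 ltW// hs.
(* For [N = 0] the sum is empty and the claim is [|F| <= G], checked factor by factor. *)
case: (posnP N) => [->|N0].
  rewrite smooth_sum_at0 sub0r normrN powR1 mul1r /F /G normr_prod.
  rewrite big_nat_cond [X in _ <= X]big_nat_cond; apply: ler_prod => p /andP[/andP[p1 pi1] pp].
  have p0 : 0 < p%:R :> R by rewrite ltr0n.
  have pw := hs _ pp pi1; rewrite normr_ge0 normfV lef_pV2 ?posrE ?normr_gt0 ?subr_gt0//.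
    apply: le_trans (ler_norm _); rewrite lerD2l lerN2 ler_pM2r ?invr_gt0//.
    apply: (@le_trans _ _ 1); first by rewrite -(cmult_norm _ p1) ler_norm.
    by rewrite -[X in X <= _](powRr0 p%:R) ler_powR ?ler1n// ltW.
  rewrite subr_eq0 gt_eqF//; apply: le_lt_trans pw; rewrite ler_pM2r ?invr_gt0//.
  apply: (@le_trans _ _ 1); first by rewrite -(cmult_norm _ p1) ler_norm.
  by rewrite -[X in X <= _](powRr0 p%:R) ler_powR ?ler1n// ltW.
rewrite smooth_sumS// [X in _ - X]FE.
have -> (a b c e : R) : a + g i.+1 / q * b - (c + g i.+1 / q * e) =
   (a - c) + g i.+1 / q * (b - e) by ring.
apply: (le_trans (ler_normD _ _)).
have IH2 := IHN _ (ltn_Pdiv (prime_gt1 pi) N0) i.+1 hs.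
have : `|g i.+1 / q * (smooth_sum g i.+1 (N %/ i.+1) - F)| <= N.+1%:R `^ (- s) * (w * G).
  have q0' := ltW q0; rewrite normrM normrM cmult_norm// mul1r ger0_norm ?invr_ge0//.
  apply: (@le_trans _ _ (q^-1 * ((N %/ i.+1).+1%:R `^ (- s) * G))).
    by rewrite ler_pM2l ?invr_gt0.
  rewrite mulrA mulrA ler_wpM2r// mulrC /w mulrA ler_pM2r ?invr_gt0//.
  (* Since [N + 1 <= p * (N %/ p + 1)], going from [N %/ p] back to [N] costs at most the factor
     [p^s] present in [w]; this is why the bound uses [N.+1]. *)
  have Ns0 : 0 < N.+1%:R `^ s :> R by rewrite powR_gt0.
  have Ds0 : 0 < (N %/ i.+1).+1%:R `^ s :> R by rewrite powR_gt0.
  rewrite !powRN [X in _ <= X]mulrC ler_pdivlMr// mulrC ler_pdivrMr// -powRM//.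
  by apply: ge0_ler_powR; rewrite ?nnegrE ?mulr_ge0 ?(ltW s0)// -natrM ler_nat mulnC ltn_ceil.
move=> h2; apply: (le_trans (lerD IHi h2)).
by rewrite GE -mulrDr mulrBr mulr1 [G * w]mulrC subrK.
Qed.

End CompletelyMultiplicative.

(** * Chebyshev and Mertens upper bounds for primes *)

Lemma prod_primes_dvdn (s : seq nat) (m : nat) : uniq s ->
  {in s, forall p, prime p && (p %| m)%N} -> (\prod_(p <- s) p %| m)%N.
Proof.
elim: s => [|p s IH] /=; first by rewrite big_nil dvd1n.
move=> /andP[ps us] h; rewrite big_cons Gauss_dvd; last first.
  rewrite coprime_sym; have /andP[pp _] := h p (mem_head _ _).
  rewrite big_seq; elim/big_rec: _ => [|q x qs cx]; first by rewrite coprime1n.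
  rewrite coprimeMl cx andbT prime_coprime; last first.
    by have /andP[] : prime q && (q %| m)%N by apply: h; rewrite inE qs orbT.
  rewrite dvdn_prime2//; last first.
    by have /andP[] : prime q && (q %| m)%N by apply: h; rewrite inE qs orbT.
  by apply/eqP => qp; rewrite -qp qs in ps.
have /andP[_ ->] := h p (mem_head _ _); apply: IH => // q qs.
by apply: h; rewrite inE qs orbT.
Qed.

Lemma bin_double_le n : ('C(n.*2, n) <= 4 ^ n)%N.
Proof.
have -> : (4 ^ n = 2 ^ n.*2)%N by rewrite -mul2n expnM.
have := expnDn 1 1 n.*2; rewrite addn1 => ->.
rewrite (bigD1 (inord n : 'I_(n.*2.+1)))//= inordK; last by rewrite ltnS -addnn leq_addr.
by rewrite !exp1n !muln1 leq_addr.
Qed.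

(** A prime in [(n, 2n]] divides [(2n)!] but not [n!], hence divides the central binomial
    coefficient. The product of these primes is at least [n] to their number and at most [4 ^ n]. *)
Lemma count_primes_double n : (n ^ count prime (index_iota n.+1 n.*2.+1) <= 4 ^ n)%N.
Proof.
apply: leq_trans (bin_double_le n).
set s := [seq p <- index_iota n.+1 n.*2.+1 | prime p].
have sP p : p \in s -> [&& prime p, (n < p)%N & (p <= n.*2)%N].
  by rewrite mem_filter mem_index_iota ltnS.
have dv : (\prod_(p <- s) p %| 'C(n.*2, n))%N.
  apply: prod_primes_dvdn => [|p /sP /and3P[pp np pn]]; first by rewrite filter_uniq ?iota_uniq.
  rewrite pp /=; have nn : (n <= n.*2)%N by rewrite -addnn leq_addr.
  have ndv k : (k <= n)%N -> ~~ (p %| k`!)%N.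
    elim: k => [_|k IH kn]; first by rewrite fact0 dvdn1; case: p pp {np pn} => [|[|]].
    have pk : ~~ (p %| k.+1)%N by rewrite gtnNdvd// (leq_ltn_trans kn np).
    by rewrite factS (Euclid_dvdM _ _ pp) negb_or pk; apply/IH/ltnW.
  have : (p %| (n.*2)`!)%N by rewrite dvdn_fact// prime_gt0.
  rewrite -(bin_fact nn) !Euclid_dvdM//.
  have -> : (n.*2 - n = n)%N by rewrite -addnn addnK.
  by rewrite (negbTE (ndv _ (leqnn _))) !orbF.
apply: leq_trans (dvdn_leq _ dv); last by rewrite bin_gt0 -addnn leq_addr.
rewrite -size_filter -/s; have : {in s, forall p, (n <= p)%N}.
  by move=> p /sP/and3P[_ /ltnW].
elim: s {sP dv} => [|p s IH] h; rewrite ?big_nil// big_cons /= expnS leq_mul ?h ?mem_head//.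
by apply: IH => q qs; apply: h; rewrite inE qs orbT.
Qed.

Lemma count_primes_dyadic j : (0 < j)%N ->
  (j * count prime (index_iota (2 ^ j).+1 (2 ^ j.+1).+1) <= 2 * 2 ^ j)%N.
Proof.
move=> j0; have := count_primes_double (2 ^ j).
by rewrite -mul2n -expnS -expnM (_ : 4 = 2 ^ 2)%N// -expnM leq_exp2l// -expnS.
Qed.

(** The block has at most [2 * 2 ^ j / j] primes, each with reciprocal at most [2 ^- j]. *)
Lemma sum_prime_inv_dyadic {R : realType} j : (0 < j)%N ->
  \sum_((2 ^ j).+1 <= p < (2 ^ j.+1).+1 | prime p) (p%:R : R)^-1 <= 2 / j%:R.
Proof.
move=> j0; have j0' : 0 < j%:R :> R by rewrite ltr0n.
apply: (@le_trans _ _ (\sum_((2 ^ j).+1 <= p < (2 ^ j.+1).+1 | prime p) ((2 ^ j)%:R : R)^-1)).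
  rewrite big_nat_cond [X in _ <= X]big_nat_cond; apply: ler_sum => p /andP[/andP[jp _] _].
  have p0 : (0 < p)%N by apply: leq_ltn_trans jp.
  have q0 : (0 < 2 ^ j)%N by rewrite expn_gt0.
  by rewrite lef_pV2 ?posrE ?ltr0n// ler_nat ltnW.
rewrite big_const_seq iter_addr_0 -[X in X <= _]mulr_natl.
have q0 : 0 < (2 ^ j)%:R :> R by rewrite ltr0n expn_gt0.
rewrite ler_pdivrMr// mulrAC ler_pdivlMr// mulrC -natrM -natrM ler_nat.
exact: count_primes_dyadic.
Qed.

Lemma sum_harmonic_le {R : realType} n : (0 < n)%N ->
  \sum_(1 <= k < n.+1) (k%:R : R)^-1 <= 1 + ln n%:R.
Proof.
elim: n => // -[_ _|n IH _]; first by rewrite big_nat1 ln1 invr1 addr0.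
rewrite big_nat_recr//=; apply: (le_trans (lerD (IH isT) (lexx _))).
rewrite -addrA lerD2l addrC -lerBrDr.
(* Apply [ln (1 + u) <= u] at [u = - 1 / (n + 2)], which bounds the new term by
   [ln (n + 2) - ln (n + 1)]. *)
have h : -1 < - (n.+2%:R : R)^-1.
  by rewrite ltrN2 invf_lt1 ?ltr0n// ltr1n.
have := le_ln1Dx h; have -> : 1 - (n.+2%:R : R)^-1 = n.+1%:R / n.+2%:R.
  rewrite -[in RHS]natr1 mulrDl; field.
  by rewrite -natr1 -natr1 gt_eqF// ltr_pwDr// ltr_pwDr// ler0n.
rewrite ln_div ?posrE ?ltr0n// lerBlDr -lerBlDl opprK => hh.
by rewrite lerBrDl.
Qed.

(* Mertens' upper bound, up to the factor [2] lost by using Chebyshev's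
   estimate on dyadic blocks. *)
Lemma sum_prime_inv_le {R : realType} J : (0 < J)%N ->
  \sum_(1 <= p < (2 ^ J).+1 | prime p) (p%:R : R)^-1 <= 5 / 2 + 2 * ln J%:R.
Proof.
move=> J0; apply: (@le_trans _ _ (2^-1 + 2 * \sum_(1 <= j < J) (j%:R : R)^-1)); last first.
  have : \sum_(1 <= j < J) (j%:R : R)^-1 <= 1 + ln J%:R.
    apply: le_trans (sum_harmonic_le J J0); rewrite [X in _ <= X]big_nat_recr//=.
    by rewrite lerDl invr_ge0.
  by move=> ?; lra.
elim: J J0 => // -[_ _|J IH _].
  rewrite big_mkcond/= [X in _ + _ * X]big_geq// big_nat_recr//= big_nat1/=; lra.
rewrite (@big_cat_nat _ _ _ (2 ^ J.+1).+1)//=; last first.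
  by rewrite ltnS leq_exp2l.
rewrite [X in _ <= _ + _ * X]big_nat_recr//= mulrDr addrA lerD ?IH//.
exact: sum_prime_inv_dyadic.
Qed.

(** * Elementary inequalities for the exponential *)

Lemma expR_half_le2 {R : realType} : expR (1 / 2) <= 2 :> R.
Proof.
have := expR_ge1Dx (- (1 / 2) : R); rewrite expRN => h.
rewrite -[leRHS]invrK -[leLHS]invrK lef_pV2 ?posrE ?invr_gt0 ?expR_gt0//; lra.
Qed.

Lemma expR1_le4 {R : realType} : expR 1 <= 4 :> R.
Proof.
have -> : 1 = 1 / 2 + 1 / 2 :> R by lra.
rewrite expRD (le_trans (ler_pM _ _ expR_half_le2 expR_half_le2)) ?expR_ge0//; lra.
Qed.

(** The one-step Hoeffding bound for a random sign. Bounding each exponential by [1 / (1 - a)] and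
    [1 / (1 + a)] gives [2 / (1 - a^2)], and [1 / (1 - b) <= 1 + 2 b] for [0 <= b <= 1/2]; hence the
    constant 2 in the exponent. *)
Lemma expRDN_le {R : realType} (a : R) : a ^+ 2 <= 1 / 2 ->
  expR a + expR (- a) <= 2 * expR (2 * a ^+ 2).
Proof.
move=> a2; have a1 : `|a| < 1.
  rewrite ltNge; apply/negP => h; have := ler_pM ler01 ler01 h h.
  by rewrite -normrM ger0_norm ?sqr_ge0// -expr2; lra.
have [al au] : -1 < a /\ a < 1 by move: a1; rewrite ltr_norml => /andP.
have e1 : expR a <= (1 - a)^-1.
  rewrite -[leLHS]invrK -expRN lef_pV2 ?posrE ?expR_gt0 ?subr_gt0//.
  exact: expR_ge1Dx.
have e2 : expR (- a) <= (1 + a)^-1.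
  by rewrite expRN lef_pV2 ?posrE ?expR_gt0 ?expR_ge1Dx//; lra.
apply: (le_trans (lerD e1 e2)).
have -> : (1 - a)^-1 + (1 + a)^-1 = 2 / (1 - a ^+ 2) by field; apply/and3P; split; lra.
rewrite ler_pM2l// (le_trans _ (expR_ge1Dx _))//.
have d0 : 0 < 1 - a ^+ 2 by lra.
rewrite -[X in X <= _]mul1r ler_pdivrMr//.
have := sqr_ge0 a; set b := a ^+ 2 in a2 d0 *; nra.
Qed.

(** * Deterministic lower bounds: martingale part and smooth part *)

Definition harmonic_sum {R : realType} (N : nat) : R := \sum_(1 <= n < N.+1) n%:R^-1.

Lemma harmonic_sum_mono {R : realType} M N : (M <= N)%N ->
  harmonic_sum M <= harmonic_sum N :> R.
Proof.
move=> MN; rewrite /harmonic_sum (@big_cat_nat _ _ _ M.+1 1 N.+1)//= lerDl.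
by apply: sumr_ge0 => i _; rewrite invr_ge0.
Qed.

(** Makes sums of [1 / p^2] over [y < p <= i] telescope to [1 / y - 1 / i]. *)
Lemma inv_sqr_le {R : realType} i : (0 < i)%N ->
  (i.+1%:R ^+ 2)^-1 <= i%:R^-1 - i.+1%:R^-1 :> R.
Proof.
move=> i0; rewrite -natr1; have h : 0 < i%:R :> R by rewrite ltr0n.
set a := i%:R in h *.
have -> : a^-1 - (a + 1)^-1 = (a * (a + 1))^-1 by field; rewrite !gt_eqF//; lra.
rewrite lef_pV2 ?posrE; [nra|nra|nra].
Qed.

(* The part of the sum over [n <= N] carried by integers whose
   largest prime factor [p] lies in [(y, i]] and divides [n] exactly once. *)
Definition martingale {R : realType} (g : nat -> R) (N y i : nat) : R :=
  \sum_(y.+1 <= p < i.+1 | prime p) g p / p%:R * smooth_sum g p.-1 (N %/ p).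

Lemma martingaleS {R : realType} (g : nat -> R) N y i : (y <= i)%N ->
  martingale g N y i.+1 = martingale g N y i +
    if prime i.+1 then g i.+1 / i.+1%:R * smooth_sum g i (N %/ i.+1) else 0.
Proof. by move=> yi; rewrite /martingale big_mkcond big_nat_recr//= -big_mkcond. Qed.

Section LowerBound.
Context {R : realType} (g : nat -> R).
Hypothesis g1 : g 1%N = 1.
Hypothesis gM : forall m n, (0 < m)%N -> (0 < n)%N -> g (m * n)%N = g m * g n.
Hypothesis gp : forall p, prime p -> g p = 1 \/ g p = -1.

Lemma smooth_sum_le_harmonic i M N : (M <= N)%N -> `|smooth_sum g i M| <= harmonic_sum N.
Proof.
move=> MN; apply: le_trans (harmonic_sum_mono _ _ MN).
exact: norm_smooth_sum_le.
Qed.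

(** Induction on [i] by [smooth_sum_split]: the quadratic term at a prime [p] is at least
    [- harmonic_sum N / p^2], and these losses telescope. *)
Lemma smooth_sum_ge_martingale N y i : (0 < y)%N -> (y <= i)%N ->
  smooth_sum g y N + martingale g N y i - harmonic_sum N * (y%:R^-1 - i%:R^-1)
  <= smooth_sum g i N.
Proof.
move=> y0; elim: i => [|i IH]; first by rewrite leqNgt y0.
rewrite leq_eqVlt => /orP[/eqP <-|].
  by rewrite /martingale big_mkcond big_geq// subrr mulr0 addr0 subr0.
rewrite ltnS => yi; rewrite martingaleS//; have {}IH := IH yi.
have i0 : (0 < i)%N by apply: leq_trans yi.
have H0 : 0 <= harmonic_sum N :> R by rewrite sumr_ge0// => n _; rewrite invr_ge0.
have inc := inv_sqr_le (R := R) i i0.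
have inc0 : 0 <= (i.+1%:R ^+ 2)^-1 :> R by rewrite invr_ge0 sqr_ge0.
case: ifP => pi; last first.
  rewrite (smooth_sumS_nprime g i N) ?pi//.
  have : 0 <= harmonic_sum N * (i%:R^-1 - i.+1%:R^-1 :> R).
    by rewrite mulr_ge0// (le_trans inc0).
  move: (i.+1%:R^-1 : R) => u; move: IH; lra.
rewrite (smooth_sum_split g gM gp)//.
have : `|smooth_sum g i.+1 (N %/ i.+1 %/ i.+1)| <= harmonic_sum N.
  by apply: smooth_sum_le_harmonic; rewrite -divnMA leq_div.
rewrite ler_norml => /andP[h _].
have h1 : 0 <= harmonic_sum N * (i%:R^-1 - i.+1%:R^-1 - (i.+1%:R ^+ 2)^-1 :> R).
  by rewrite mulr_ge0// subr_ge0.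
have h2 : 0 <= (i.+1%:R ^+ 2)^-1 *
    (smooth_sum g i.+1 (N %/ i.+1 %/ i.+1) + harmonic_sum N).
  by rewrite mulr_ge0//; lra.
move: IH h1 h2; set t := g i.+1 / _ * _.
move: (i.+1%:R^-1 : R) ((i.+1%:R ^+ 2)^-1 : R) => u u2; lra.
Qed.

(** Each Euler factor is at least [1 / (1 + 1/p) >= exp (- 1/p)], which gives [expR (- W)]. In
    Rankin's product each factor is at most [exp (16 / p)]: one 4 comes from [p^s <= 4], the other
    from [1 / (1 - w) <= 1 + 4 w] for [0 <= w <= 3/4]. *)
Lemma smooth_sum_ge (s W : R) (y N : nat) : 0 < s -> s <= 1 / 2 ->
  (forall p, prime p -> (p <= y)%N -> p%:R `^ s <= 4) ->
  \sum_(1 <= p < y.+1 | prime p) p%:R^-1 <= W ->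
  expR (- W) - N.+1%:R `^ (- s) * expR (16 * W) <= smooth_sum g y N.
Proof.
move=> s0 s1 h4 hW.
(* As [s <= 1/2] and [p >= 2], the quotient is at most [1 / sqrt 2]. *)
have hw p : prime p -> (p <= y)%N -> p%:R `^ s / p%:R <= 3 / 4.
  move=> pp py; have p2 : 2 <= p%:R :> R by rewrite ler_nat prime_gt1.
  set q : R := p%:R in p2 *; have q0 : 0 < q by lra.
  have qs : q `^ s <= q `^ (2^-1) by rewrite ler_powR//; lra.
  have qq : q `^ (2^-1) * q `^ (2^-1) = q.
    rewrite -powRD; last by rewrite gt_eqF// implybT.
    by rewrite (_ : 2^-1 + 2^-1 = 1) ?powRr1// ?ltW//; lra.
  have q20 := powR_gt0 2^-1 q0.
  rewrite ler_pdivrMr// (le_trans qs)//; nra.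
have hs p : prime p -> (p <= y)%N -> p%:R `^ s / p%:R < 1.
  by move=> pp py; apply: (le_lt_trans (hw p pp py)); lra.
have := smooth_sum_euler g g1 gM gp s y N s0 hs.
set F := \prod_(1 <= p < y.+1 | prime p) (1 - g p / p%:R)^-1.
set G := \prod_(1 <= p < y.+1 | prime p) (1 - p%:R `^ s / p%:R)^-1.
have FW : expR (- W) <= F.
  apply: (@le_trans _ _ (expR (- \sum_(1 <= p < y.+1 | prime p) p%:R^-1))).
    by rewrite ler_expR lerN2.
  rewrite -sumrN expR_sum /F big_nat_cond [leRHS]big_nat_cond.
  apply: ler_prod => p /andP[/andP[p1 py] pp]; rewrite expR_ge0/= expRN.
  have gp1 := cmult_norm g g1 gM gp p p1.
  have p2 : 2 <= p%:R :> R by rewrite ler_nat prime_gt1.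
  have p0 : 0 < (p%:R : R)^-1 by rewrite invr_gt0; lra.
  have p3 : (p%:R : R)^-1 <= 2^-1 by rewrite lef_pV2 ?posrE//; lra.
  have := lexx `|g p|; rewrite {2}gp1 ler_norml => /andP[ga gb].
  rewrite lef_pV2 ?posrE ?expR_gt0//; last nra.
  apply: le_trans (expR_ge1Dx _); nra.
have GW : G <= expR (16 * W).
  apply: (@le_trans _ _ (expR (16 * \sum_(1 <= p < y.+1 | prime p) p%:R^-1))); last first.
    by rewrite ler_expR ler_pM2l.
  rewrite mulr_sumr expR_sum /G big_nat_cond [leRHS]big_nat_cond.
  apply: ler_prod => p /andP[/andP[p1 py] pp].
  have hw1 := hw p pp py; have hs1 := hs p pp py.
  have p0 : 0 < (p%:R : R)^-1 by rewrite invr_gt0 ltr0n.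
  have w4 : p%:R `^ s / p%:R <= 4 * p%:R^-1 by rewrite ler_wpM2r ?h4// ltW.
  have w0 : 0 <= p%:R `^ s / p%:R by rewrite mulr_ge0 ?powR_ge0 ?ltW.
  set w := p%:R `^ s / p%:R in hw1 hs1 w4 w0 *.
  rewrite invr_ge0 subr_ge0 ltW//=.
  apply: (@le_trans _ _ (expR (4 * w))); last by rewrite ler_expR; lra.
  apply: le_trans (expR_ge1Dx _).
  rewrite -[X in X <= _]mul1r ler_pdivrMr ?subr_gt0//; nra.
rewrite ler_norml => /andP[h _].
have N0 : 0 <= N.+1%:R `^ (- s) :> R by rewrite powR_ge0.
nra.
Qed.

End LowerBound.

(* The primes above [N] get the value [1]. *)
Definition cmult_ext {R : realType} (N : nat) (v : nat -> R) (n : nat) : R :=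
  \prod_(1 <= p < N.+1 | prime p) v p ^+ logn p n.

(** * Multiplicative functions built from finitely many signs *)

Section CmultExt.
Context {R : realType} (N : nat).
Implicit Types v : nat -> R.

Lemma cmult_ext1 v : cmult_ext N v 1 = 1.
Proof. by rewrite /cmult_ext big1// => p _; rewrite logn1 expr0. Qed.

Lemma cmult_extM v m n : (0 < m)%N -> (0 < n)%N ->
  cmult_ext N v (m * n) = cmult_ext N v m * cmult_ext N v n.
Proof.
by move=> m0 n0; rewrite -big_split; apply: eq_bigr => p _; rewrite lognM// exprD.
Qed.

Lemma cmult_ext_gt v q : prime q -> (N < q)%N -> cmult_ext N v q = 1.
Proof.
move=> pq Nq; rewrite /cmult_ext big_nat_cond big1// => p /andP[/andP[_ pN] _].
by rewrite logn_prime// ltn_eqF ?expr0// (leq_trans pN Nq).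
Qed.

Lemma cmult_ext_le v q : prime q -> (q <= N)%N -> cmult_ext N v q = v q.
Proof.
move=> pq qN; rewrite /cmult_ext (big_rem q) /=; last by rewrite mem_index_iota prime_gt0.
rewrite pq logn_prime// eqxx expr1 big_seq_cond big1 ?mulr1// => p /andP[].
by rewrite mem_rem_uniq ?iota_uniq// inE => /andP[/negbTE pq' _] _; rewrite logn_prime// pq'.
Qed.

Lemma cmult_ext_prime v : (forall p, v p = 1 \/ v p = -1) ->
  forall p, prime p -> cmult_ext N v p = 1 \/ cmult_ext N v p = -1.
Proof.
move=> hv p pp; case: (leqP p N) => pN; first by rewrite cmult_ext_le.
by rewrite cmult_ext_gt//; left.
Qed.

Lemma eq_cmult_ext v v' n : (forall p, prime p -> (p <= N)%N -> (p %| n)%N -> v p = v' p) ->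
  cmult_ext N v n = cmult_ext N v' n.
Proof.
move=> h; rewrite /cmult_ext big_nat_cond [RHS]big_nat_cond; apply: eq_bigr => p.
move=> /andP[/andP[p1 pN] pp].
case: (boolP (p %| n)%N) => pn; first by rewrite h.
by rewrite lognE (negbTE pn) !andbF !expr0.
Qed.

Lemma cmult_ext_id (g : nat -> R) n : g 1%N = 1 ->
  (forall m n, (0 < m)%N -> (0 < n)%N -> g (m * n)%N = g m * g n) ->
  (0 < n)%N -> (n <= N)%N -> cmult_ext N g n = g n.
Proof.
move=> g1 gM; elim/ltn_ind: n => n IH n0 nN; case: (ltnP 1 n) => [n1|]; last first.
  by case: n n0 {IH nN} => [|[|//]] // _ _; rewrite cmult_ext1.
have pp := pdiv_prime n1; have := pdiv_dvd n => /dvdnP[k kE].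
have k0 : (0 < k)%N by case: k kE => // kE; rewrite kE in n0.
have kn : (k < n)%N by rewrite [ltnRHS]kE ltn_Pmulr// prime_gt1.
rewrite kE gM ?pdiv_gt0// cmult_extM ?pdiv_gt0// IH//; last exact: leq_trans (ltnW kn) nN.
by rewrite cmult_ext_le// (leq_trans (pdiv_leq n0)).
Qed.

End CmultExt.

Definition update {R : Type} (v : nat -> R) (i : nat) (e : R) : nat -> R :=
  fun p => if p == i then e else v p.

(** All sign patterns on the primes up to [i], with value 1 everywhere else. Expectations become
    finite sums over this list, and probabilities become proportions. *)
Fixpoint signs {R : realType} (i : nat) : seq (nat -> R) :=
  if i is j.+1 then
    if prime i then
      [seq update v i 1 | v <- signs j] ++ [seq update v i (-1) | v <- signs j]
    else signs j
  else [:: fun=> 1].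

Section Signs.
Context {R : realType}.

Lemma size_signs i : size (@signs R i) = (2 ^ count prime (index_iota 1 i.+1))%N.
Proof.
elim: i => [|i IH] //; move: IH; rewrite /index_iota !subSS !subn0 => IH.
rewrite (_ : iota 1 i.+1 = iota 1 i ++ [:: i.+1]); last by rewrite -{1}(addn1 i) iotaD.
rewrite count_cat [signs _]/= [count _ [:: _]]/= addn0; case: ifP => pi; last by rewrite addn0 IH.
by rewrite addn1 expnS size_cat !size_map addnn -mul2n IH.
Qed.

Lemma signs_pm1 i v : v \in @signs R i -> forall p, v p = 1 \/ v p = -1.
Proof.
elim: i v => [|i IH] v; first by rewrite inE => /eqP -> p; left.
rewrite /=; case: ifP => _; last exact: IH.
rewrite mem_cat => /orP[] /mapP[u /IH hu ->] p; rewrite /update; case: eqP => _ //;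
  by [left|right].
Qed.

Lemma signs_cover i (h : nat -> R) : (forall p, prime p -> h p = 1 \/ h p = -1) ->
  exists2 v, v \in signs i & forall p, prime p -> (p <= i)%N -> h p = v p.
Proof.
move=> h1; elim: i => [|i [v vi hv]].
  by exists (fun=> 1); rewrite ?inE// => -[].
rewrite /=; case: ifP => pi; last first.
  exists v => // p pp; rewrite leq_eqVlt ltnS => /orP[/eqP pE|]; last exact: hv.
  by rewrite pE pi in pp.
have [hi|hi] := h1 _ pi.
- exists (update v i.+1 1); first by rewrite mem_cat; apply/orP; left; apply/mapP; exists v.
  move=> p pp; rewrite /update leq_eqVlt ltnS; case: eqP => [-> //|_] /=; exact: hv.
- exists (update v i.+1 (-1)); first by rewrite mem_cat; apply/orP; right; apply/mapP; exists v.
  move=> p pp; rewrite /update leq_eqVlt ltnS; case: eqP => [-> //|_] /=; exact: hv.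
Qed.

Lemma cmult_ext_update N (v : nat -> R) i e n : (0 < n)%N -> smooth i n ->
  cmult_ext N (update v i.+1 e) n = cmult_ext N v n.
Proof.
move=> n0 /allP sn; apply: eq_cmult_ext => p pp _ pn; rewrite /update ltn_eqF// ltnS.
by apply: sn; rewrite mem_primes pp n0.
Qed.

Lemma eq_smooth_sum (g g' : nat -> R) i N :
  (forall n, (0 < n)%N -> smooth i n -> g n = g' n) -> smooth_sum g i N = smooth_sum g' i N.
Proof.
move=> h; rewrite /smooth_sum big_nat_cond [RHS]big_nat_cond.
by apply: eq_bigr => n /andP[/andP[n0 _] sn]; rewrite h.
Qed.

Lemma smoothW i j n : (i <= j)%N -> smooth i n -> smooth j n.
Proof. by move=> ij /allP h; apply/allP => p /h /leq_trans; apply. Qed.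

(** Adaptedness: the terms with [p <= i] involve only signs at primes up to [i]. *)
Lemma martingale_update N y i (v : nat -> R) e :
  martingale (cmult_ext N (update v i.+1 e)) N y i = martingale (cmult_ext N v) N y i.
Proof.
rewrite /martingale big_nat_cond [RHS]big_nat_cond; apply: eq_bigr => p /andP[/andP[yp pi] pp].
rewrite cmult_ext_update ?prime_gt0 ?smooth_ge//; congr (_ * _).
apply: eq_smooth_sum => n n0 sn; apply: cmult_ext_update => //.
by apply: smoothW sn; rewrite (leq_trans (leq_pred _)).
Qed.

(** Azuma's induction. A new prime [p] doubles the list, and summing over its sign gives
    [expR a + expR (- a)] with [|a| <= l * H / p]. The condition on [l] keeps [a^2] below the
    threshold of [expRDN_le], and the exponents telescope by [inv_sqr_le]. *)
Lemma signs_mgf (N y i : nat) (l : R) : (0 < y)%N -> (y <= i)%N -> (i <= N)%N ->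
  0 <= l -> l * harmonic_sum N <= y%:R / 2 ->
  \sum_(v <- signs i) expR (- l * martingale (cmult_ext N v) N y i) <=
  (size (@signs R i))%:R * expR (2 * (l * harmonic_sum N) ^+ 2 * (y%:R^-1 - i%:R^-1)).
Proof.
move=> y0 + + l0; set H := harmonic_sum N => yi iN lH.
have H0 : 0 <= H by rewrite sumr_ge0// => n _; rewrite invr_ge0.
elim: i yi iN => [|i IH]; first by rewrite leqNgt y0.
rewrite leq_eqVlt => /orP[/eqP <- _|].
  rewrite subrr mulr0 expR0 mulr1.
  under eq_bigr do rewrite /martingale big_mkcond big_geq// mulr0 expR0.
  by rewrite big_const_seq count_predT iter_addr_0.
rewrite ltnS => yi iN; have {}IH := IH yi (ltnW iN).
have i0 : (0 < i)%N by apply: leq_trans yi.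
have inc := inv_sqr_le (R := R) i i0.
set B := 2 * (l * H) ^+ 2 in IH *.
have B0 : 0 <= B by rewrite mulr_ge0// sqr_ge0.
have Binc : B * (i.+1%:R ^+ 2)^-1 + B * (y%:R^-1 - i%:R^-1) <= B * (y%:R^-1 - i.+1%:R^-1).
  rewrite -mulrDr ler_wpM2l//; move: inc.
  move: (i.+1%:R^-1 : R) ((i.+1%:R ^+ 2)^-1 : R) => u u2; lra.
under eq_big_seq => v vi do rewrite martingaleS//.
rewrite [signs i.+1]/=; case: ifP => pi; last first.
  under eq_bigr do rewrite addr0.
  apply: (le_trans IH); rewrite ler_wpM2l// ler_expR (le_trans _ Binc)// lerDr.
  by rewrite mulr_ge0// invr_ge0 sqr_ge0.
rewrite big_cat !big_map /= -big_split /= size_cat !size_map addnn -mul2n natrM.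
apply: (@le_trans _ _ (\sum_(v <- signs i)
  (2 * expR (B * (i.+1%:R ^+ 2)^-1)) * expR (- l * martingale (cmult_ext N v) N y i))).
  rewrite big_seq [leRHS]big_seq; apply: ler_sum => v vi.
  (* The two copies of [v] differ only in the sign multiplying the new increment; the earlier
     martingale and the coefficient do not see it. *)
  rewrite !martingale_update !cmult_ext_le// /update eqxx.
  set c := smooth_sum (cmult_ext N (update v i.+1 1)) i (N %/ i.+1).
  have cE e : smooth_sum (cmult_ext N (update v i.+1 e)) i (N %/ i.+1) =
      smooth_sum (cmult_ext N v) i (N %/ i.+1).
    by apply: eq_smooth_sum => n n0 sn; exact: cmult_ext_update.
  rewrite /c !cE; set m := martingale _ _ _ _; set d := smooth_sum _ _ _.
  have dH : `|d| <= H.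
    apply: smooth_sum_le_harmonic; rewrite ?leq_div//.
    - exact: cmult_ext1.
    - exact: cmult_extM.
    - by apply: cmult_ext_prime; apply: signs_pm1 vi.
  set q : R := i.+1%:R; have q0 : 0 < q by rewrite ltr0n.
  pose a := l * (d / q).
  have -> : - l * (m + 1 / q * d) = - l * m + - a by rewrite /a; ring.
  have -> : - l * (m + -1 / q * d) = - l * m + a by rewrite /a; ring.
  rewrite !expRD -mulrDr addrC mulrC ler_wpM2r ?expR_ge0//.
  have d2 : d ^+ 2 <= H ^+ 2 by move: dH; rewrite ler_norml => /andP[]; nra.
  have aE : a ^+ 2 = (l * d) ^+ 2 / q ^+ 2 by rewrite /a; field; rewrite gt_eqF.
  have ld : (l * d) ^+ 2 <= (l * H) ^+ 2 by rewrite !exprMn ler_wpM2l ?sqr_ge0.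
  have yq : y%:R <= q by rewrite ler_nat leqW.
  have lHq : (l * H) ^+ 2 <= (q / 2) ^+ 2.
    by rewrite ler_sqr ?nnegrE ?mulr_ge0//; lra.
  apply: (le_trans (expRDN_le a _)).
    by rewrite aE ler_pdivrMr ?exprn_gt0//; nra.
  rewrite ler_pM2l// ler_expR /B -mulrA ler_pM2l// aE ler_wpM2r// invr_ge0 sqr_ge0//.
rewrite -big_distrr /=.
apply: (le_trans (ler_wpM2l _ IH)); first by rewrite mulr_ge0// expR_ge0.
rewrite mulrACA ler_wpM2l// -?expRD ?ler_expR//; by rewrite mulr_ge0.
Qed.

(** Markov's inequality for the exponential moment of [signs_mgf], in counting form. *)
Lemma count_signs_martingale (N y : nat) (l t : R) : (0 < y)%N -> (y <= N)%N ->
  0 <= l -> l * harmonic_sum N <= y%:R / 2 ->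
  (count (fun v => martingale (cmult_ext N v) N y N <= - t) (signs N))%:R <=
  (size (@signs R N))%:R * expR (2 * (l * harmonic_sum N) ^+ 2 / y%:R - l * t).
Proof.
move=> y0 yN l0 lH; have h := signs_mgf N y N l y0 yN (leqnn _) l0 lH.
rewrite expRD mulrA expRN ler_pdivlMr ?expR_gt0//.
apply: (@le_trans _ _
  (\sum_(v <- signs N) expR (- l * martingale (cmult_ext N v) N y N))); last first.
  have B0 : 0 <= 2 * (l * harmonic_sum N) ^+ 2 by rewrite mulr_ge0// sqr_ge0.
  by apply: (le_trans h); rewrite ler_wpM2l// ler_expR ler_wpM2l// gerBl invr_ge0.
rewrite -sum1_count natr_sum mulr_suml big_mkcond /=; apply: ler_sum => v _.
case: ifP => [hv|_]; last exact: expR_ge0.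
by rewrite mul1r ler_expR; nra.
Qed.

End Signs.

(** * From counting sign patterns to probability *)

Section Probability.
Context {R : realType} {d : measure_display} {T : measurableType d}.
Context (P : probability T R) (f : nat -> {RV P >-> R}).
Hypothesis hf : random_completely_multiplicative f.

Let atom (N : nat) (v : nat -> R) : set T :=
  \bigcap_(p in [set` [seq p <- index_iota 1 N.+1 | prime p]]) (f p @^-1` [set v p]).

Lemma measurable_atom N v : measurable (atom N v).
Proof.
apply: fin_bigcap_measurable; first exact: finite_seq.
by move=> p _; rewrite -[X in measurable X]setTI; exact: measurable_funPT.
Qed.

(** By independence each prime up to [N] contributes 1/2. With [size_signs], every pattern in
    [signs N] has the same mass. *)
Lemma prob_atom N v : (forall p, v p = 1 \/ v p = -1) ->
  P (atom N v) = ((2 ^- count prime (index_iota 1 N.+1))%:E).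
Proof.
move=> hv; rewrite /atom (rcm_indep hf (B := fun p => [set v p])).
- rewrite -size_filter.
  have : all prime [seq p <- index_iota 1 N.+1 | prime p] by exact: filter_all.
  elim: [seq _ <- _ | _] => [|p s IH] /=; first by rewrite big_nil expr0 invr1.
  move=> /andP[pp /IH {}IH]; rewrite big_cons IH exprS invfM EFinM; congr (_ * _)%E.
  have [->|->] := hv p; [exact: (rcm_prob1 hf)|exact: (rcm_probN1 hf)].
- by rewrite filter_uniq ?iota_uniq.
- by move=> p /=; rewrite mem_filter => /andP[].
- by move=> p; exact: measurable_set1.
Qed.

(** A union bound over a list, peeling off the part of [B] inside one [A v] at a time. *)
Lemma prob_le_sum_cover (A : (nat -> R) -> set T) (B : set T) (e : R) (s : seq (nat -> R)) :
  measurable B -> (forall v, measurable (A v)) ->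
  (forall v, v \in s -> (P (A v) <= e%:E)%E) ->
  B `<=` [set w | exists2 v, v \in s & A v w] ->
  (P B <= ((size s)%:R * e)%:E)%E.
Proof.
move=> mB mA; elim: s B mB => [|v s IH] B mB hA hB.
  rewrite mul0r (_ : B = set0) ?measure0//.
  by rewrite -subset0 => w /hB[].
have -> : B = (B `&` A v) `|` (B `\` A v) by rewrite setUIDK.
apply: (le_trans (measureU2 P _ _)); [exact: measurableI|exact: measurableD|].
have -> : (size (v :: s))%:R * e = e + (size s)%:R * e by rewrite /= -natr1; ring.
rewrite EFinD; apply: leeD.
  apply: (@le_trans _ _ (P (A v))); last by apply: hA; exact: mem_head.
  by apply: le_measure; rewrite ?inE//; exact: measurableI.
apply: IH; first exact: measurableD.
  by move=> u us; apply: hA; rewrite inE us orbT.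
move=> w [/hB[u]]; rewrite inE => /orP[/eqP -> //|us] Au _; by exists u.
Qed.

(** The complementary event is covered by the atoms of the patterns with nonpositive sum, each of
    mass [1 / size (signs N)]. *)
Lemma prob_sum_gt0 (N : nat) :
  ((1 - (count (fun v => \sum_(1 <= n < N.+1) cmult_ext N v n / n%:R <= 0) (@signs R N))%:R /
     (size (@signs R N))%:R)%:E
   <= P [set w | (0 < \sum_(1 <= n < N.+1) f n w / n%:R)%R])%E.
Proof.
set G := [set w | _]; set bad := fun v : nat -> R => _ <= 0.
have mS : measurable_fun setT (fun w => \sum_(1 <= n < N.+1) f n w / n%:R).
  apply: measurable_sum => n.
  by apply: measurable_realfun.measurable_funM => //; exact: measurable_funPT.
have mG : measurable G.
  have -> : G = (fun w => \sum_(1 <= n < N.+1) f n w / n%:R) @^-1` `]0, +oo[%classic.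
    by apply/seteqP; split => w /=; rewrite in_itv/= andbT.
  by rewrite -[X in measurable X]setTI; apply: mS => //; exact: measurable_itv.
have mC : measurable (~` G) by exact: measurableC.
have hC : (P (~` G) <= ((count bad (signs N))%:R / (size (@signs R N))%:R)%:E)%E.
  rewrite -size_filter; apply: (prob_le_sum_cover (atom N)) => //.
  - exact: measurable_atom.
  - move=> v; rewrite mem_filter => /andP[_ vs].
    rewrite prob_atom ?size_signs ?natrX//; exact: signs_pm1 vs.
  - move=> w /negP; rewrite -leNgt => Gw.
    have [v vs hv] := signs_cover N (f^~ w) (fun p => rcm_prime hf w).
    exists v; last first.
      move=> p /=; rewrite mem_filter mem_index_iota ltnS => /and3P[pp _ pN].
      exact: hv.
    rewrite mem_filter vs andbT /bad; apply: le_trans Gw.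
    (* On the atom of [v] the two sums agree term by term, since [n <= N] has all its prime factors
       up to [N]. *)
    rewrite big_nat [leRHS]big_nat; apply: ler_sum => n /andP[n0 nN].
    rewrite -(eq_cmult_ext N (f^~ w)) ?cmult_ext_id//; first exact: (rcm_one hf).
      by move=> m k m0 k0; exact: (rcm_mul hf).
    by move=> p pp pN _; exact: hv.
have -> : P G = (1 - P (~` G))%E by rewrite -probability_setC// setCK.
rewrite EFinB; exact: leeB.
Qed.

End Probability.

(** * Tail bound with free parameters *)

Section Tail.
Context {R : realType} {d : measure_display} {T : measurableType d}.
Context (P : probability T R) (f : nat -> {RV P >-> R}).
Hypothesis hf : random_completely_multiplicative f.

(** The last hypothesis says that the smooth part, after all errors, is at least [t]; so a
    nonpositive sum forces the martingale down to [- t]. *)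
Lemma prob_sum_gt0_ge (N y : nat) (s W t : R) : (0 < y)%N -> (y <= N)%N ->
  0 < s -> s <= 1 / 2 -> (forall p, prime p -> (p <= y)%N -> p%:R `^ s <= 4) ->
  \sum_(1 <= p < y.+1 | prime p) p%:R^-1 <= W -> 0 <= t -> t <= 1 ->
  t <= expR (- W) - N.+1%:R `^ (- s) * expR (16 * W) - harmonic_sum N / y%:R ->
  ((1 - expR (- (t ^+ 2 * y%:R / (8 * harmonic_sum N ^+ 2))))%:E
   <= P [set w | (0 < \sum_(1 <= n < N.+1) f n w / n%:R)%R])%E.
Proof.
move=> y0 yN s0 s1 h4 hW t0 t1 ht.
have y0' : 0 < y%:R :> R by rewrite ltr0n.
have H1 : 1 <= harmonic_sum N :> R.
  apply: le_trans (harmonic_sum_mono 1 N (leq_trans y0 yN)).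
  by rewrite /harmonic_sum big_nat1 invr1.
set H := harmonic_sum N in H1 ht *; have H0 : 0 < H by apply: lt_le_trans H1.
apply: le_trans (prob_sum_gt0 P f hf N); rewrite lee_fin lerD2l lerN2.
have sz : 0 < (size (@signs R N))%:R :> R by rewrite size_signs ltr0n expn_gt0.
(* This [l] minimises the exponent [2 (l H)^2 / y - l t]; it is admissible because [t <= 1 <= H]. *)
pose l := t * y%:R / (4 * H ^+ 2).
have l0 : 0 <= l by rewrite /l divr_ge0 ?mulr_ge0 ?sqr_ge0// ltW.
have lH : l * H = y%:R / 2 * (t / (2 * H)) by rewrite /l; field; rewrite gt_eqF.
have lHy : l * H <= y%:R / 2.
  have tH : t / (2 * H) <= 1 by rewrite ler_pdivrMr; lra.
  by rewrite lH -[leRHS]mulr1 ler_wpM2l// divr_ge0// ltW.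
have := count_signs_martingale N y l t y0 yN l0 lHy.
have -> : 2 * (l * harmonic_sum N) ^+ 2 / y%:R - l * t = - (t ^+ 2 * y%:R / (8 * H ^+ 2)).
  by rewrite -/H /l; field; rewrite !gt_eqF.
move=> hc; rewrite ler_pdivrMr// mulrC; apply: le_trans hc.
rewrite ler_nat -!sum1_count big_mkcond [leqRHS]big_mkcond big_seq [leqRHS]big_seq /=.
apply: leq_sum => v vs; case: ifP => // bad; case: ifP => // /negP[].
have e1 := cmult_ext1 N v; have eM := cmult_extM N v.
have ep := cmult_ext_prime N v (signs_pm1 N v vs).
have h1 := smooth_sum_ge (cmult_ext N v) e1 eM ep s W y N s0 s1 h4 hW.
have h2 := smooth_sum_ge_martingale (cmult_ext N v) e1 eM ep N y N y0 yN.
have h3 : harmonic_sum N * (y%:R^-1 - N%:R^-1) <= H / y%:R :> R.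
  by rewrite ler_wpM2l ?(ltW H0)// gerBl invr_ge0.
move: bad; rewrite -smooth_sum_top => bad; move: ht h1 h2 h3 bad; lra.
Qed.

End Tail.

(** * Choice of the parameters *)

Lemma expR_ge_sqr {R : realType} (l : R) : 400 <= l -> 560 * l ^+ 2 <= expR l.
Proof.
move=> hl; have l0 : 0 <= l by lra.
have := expR_ge1Dxn 3 l0; rewrite (_ : 4`! = 24)%N//.
have : 400 * 400 <= l ^+ 2 by exact: (ler_pM (ler0n _ _) (ler0n _ _) hl hl).
rewrite (_ : l ^+ 4 = l ^+ 2 * l ^+ 2); last by ring.
move: (l ^+ 2) => q; nra.
Qed.

Lemma sum_prime_inv_le_ln {R : realType} (y : nat) (L : R) : 2 <= L ->
  y%:R <= expR (L / 4) ->
  \sum_(1 <= p < y.+1 | prime p) (p%:R : R)^-1 <= 5 / 2 + 2 * ln L.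
Proof.
move=> L2 yL; set J := Num.truncn L.
have L0 : 0 <= L by lra.
have J0 : (0 < J)%N by rewrite truncn_gt0; lra.
have JL : J%:R <= L by rewrite truncn_le.
have LJ : L < J%:R + 1 by rewrite natr1 truncnS_gt.
(* From [L >= 2] one gets [J >= L / 2], so [y <= exp (L / 4) <= exp (J / 2) <= 2 ^ J]. *)
have yJ : (y <= 2 ^ J)%N.
  rewrite -(ler_nat R) natrX (le_trans yL)//.
  apply: (@le_trans _ _ (expR (1 / 2) ^+ J)).
    by rewrite -expRM_natr ler_expR; lra.
  by rewrite lerXn2r ?nnegrE ?expR_ge0// expR_half_le2.
apply: (@le_trans _ _ (5 / 2 + 2 * ln J%:R)); last first.
  by rewrite lerD2l ler_pM2l// ler_ln ?posrE ?ltr0n//; lra.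
apply: le_trans (sum_prime_inv_le J J0).
rewrite [leRHS](@big_cat_nat _ _ _ y.+1)//= lerDl.
by apply: sumr_ge0 => p _; rewrite invr_ge0.
Qed.

Theorem theorem1p2 (R : realType) (d : measure_display)
    (T : measurableType d) (P : probability T R) (f : nat -> {RV P >-> R})
    (hf : random_completely_multiplicative f) :
  exists C C' x0 : R, 0 < C /\ 0 < C' /\
    forall x : R, x0 <= x ->
      ((1 - C' * expR (- expR (ln x / (C * ln (ln x)))))%R%:E <=
       P [set w | (0 < \sum_(1 <= n < (Num.truncn x).+1) f n w / n%:R)%R])%E.
Proof.
(* This [x0] ensures [ln (ln x) >= 400]. *)
exists 80, 1, (expR (expR 400)); split=> //; split=> // x hx.
have x0 : 0 < x by apply: lt_le_trans hx; exact: expR_gt0.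
set L := ln x; set l := ln L.
have hL : expR 400 <= L by rewrite -ler_expR lnK.
have L0 : 0 < L by apply: lt_le_trans hL; exact: expR_gt0.
have hl : 400 <= l by rewrite -ler_expR lnK.
have LE : expR l = L by rewrite lnK.
have l0 : 0 < l by lra.
have Ll := expR_ge_sqr l hl; rewrite LE in Ll.
(* With [y = x^(1 / (40 log log x))] Rankin's tail saves [(log x)^(-40)], which
   beats the factor [expR (16 * W) = O((log x)^32)]. *)
set M := L / (80 * l).
have LM : L = 80 * l * M by rewrite /M mulrC divfK// gt_eqF//; lra.
(* The constant 560 in [expR_ge_sqr] is [7 * 80]. Since [Y = exp (2 M)] while the target is only
   [exp M], the spare [exp M >= (log x)^7] absorbs the powers of [log x] lost later. *)
have M7 : 7 * l <= M by rewrite /M ler_pdivlMr; [nra|lra].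
set Y := expR (2 * M); set y := Num.truncn Y; set N := Num.truncn x.
have Y0 : 0 < Y := expR_gt0 _.
have Y2 : 2 <= Y by apply: le_trans (expR_ge1Dx _); lra.
have yY : y%:R <= Y by rewrite truncn_le ltW.
have Yy : Y / 2 <= y%:R.
  have : Y < y.+1%:R by exact: truncnS_gt.
  by rewrite -natr1; lra.
have y0 : (0 < y)%N by rewrite truncn_gt0; lra.
have y0' : 0 < y%:R :> R by rewrite ltr0n.
have xE : x = expR L by rewrite lnK.
have Yx : Y <= x by rewrite xE ler_expR LM; nra.
have yN : (y <= N)%N by exact: le_truncn.
have Nx : N%:R <= x by rewrite truncn_le ltW.
have N0 : (0 < N)%N by apply: leq_trans yN.
(* [W] is the Mertens bound, so [expR (- W)] is a constant over [(log x)^2]. The choice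
   [s = 1 / ln Y] makes [Y^s = e]. Half of [expR (- W)] is kept as [t]; each of the two errors may
   use a quarter. *)
pose W := 5 / 2 + 2 * l; pose s := 1 / (2 * M); pose t := expR (- W) / 2.
have s0 : 0 < s by rewrite divr_gt0//; lra.
have s1 : s <= 1 / 2 by rewrite ler_pdivrMr; lra.
have h4 p : prime p -> (p <= y)%N -> p%:R `^ s <= 4.
  move=> _ py; apply: le_trans expR1_le4.
  rewrite (_ : expR 1 = Y `^ s); last first.
    by rewrite -expRM /s; congr expR; field; rewrite gt_eqF//; lra.
  rewrite ge0_ler_powR ?nnegrE ?(ltW s0) ?(ltW Y0)//.
  by apply: le_trans yY; rewrite ler_nat.
have hW : \sum_(1 <= p < y.+1 | prime p) p%:R^-1 <= W.
  apply: sum_prime_inv_le_ln; first nra.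
  by apply: (le_trans yY); rewrite ler_expR LM; nra.
have t0 : 0 <= t by rewrite divr_ge0 ?expR_ge0.
have eW1 : expR (- W) <= 1 by rewrite expR_le1 /W; lra.
(* Replacing the constant 4 by [expR 3] reduces the comparisons below to linear inequalities between
   exponents. *)
have e3 : 4 <= expR 3 :> R by apply: le_trans (expR_ge1Dx _); lra.
have t1 : t <= 1 by rewrite /t; lra.
have HL : harmonic_sum N <= 2 * expR l.
  apply: (le_trans (sum_harmonic_le N N0)); rewrite LE.
  have : ln N%:R <= L by rewrite ler_ln ?posrE ?ltr0n.
  nra.
have H1 : 1 <= harmonic_sum N :> R.
  apply: le_trans (harmonic_sum_mono 1 N N0).
  by rewrite /harmonic_sum big_nat1 invr1.
have el := expR_gt0 l.
have err1 : N.+1%:R `^ (- s) * expR (16 * W) <= expR (- W) / 4.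
  rewrite ler_pdivlMr//; apply: (@le_trans _ _ (expR (- (40 * l)) * expR (16 * W) * expR 3)).
    rewrite ler_pM ?mulr_ge0 ?powR_ge0 ?expR_ge0// ler_wpM2r ?expR_ge0//.
    have -> : expR (- (40 * l)) = x `^ (- s).
      by rewrite xE -expRM LM /s; congr expR; field; rewrite gt_eqF//; lra.
    rewrite !powRN lef_pV2 ?posrE ?powR_gt0 ?ltr0n//.
    by rewrite ge0_ler_powR ?nnegrE ?(ltW s0) ?(ltW x0)// ltW// truncnS_gt.
  by rewrite -!expRD ler_expR /W; lra.
have err2 : harmonic_sum N / y%:R <= expR (- W) / 4.
  rewrite ler_pdivrMr//; apply: (le_trans HL).
  apply: (@le_trans _ _ (expR (- W) / 4 * (Y / 2))); last by rewrite ler_pM2l ?divr_gt0 ?expR_gt0.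
  have : expR l * (4 * 4) <= expR (- W) * Y.
    apply: (@le_trans _ _ (expR l * (expR 3 * expR 3))).
      by rewrite ler_pM2l// ler_pM.
    by rewrite -!expRD ler_expR /W; lra.
  lra.
have ht : t <= expR (- W) - N.+1%:R `^ (- s) * expR (16 * W) - harmonic_sum N / y%:R.
  rewrite /t; lra.
apply: le_trans (prob_sum_gt0_ge P f hf N y s W t y0 yN s0 s1 h4 hW t0 t1 ht).
rewrite lee_fin mul1r lerD2l lerN2 ler_expR lerN2 -/M.
have HH : harmonic_sum N ^+ 2 <= 4 * expR l ^+ 2 by rewrite !expr2; nra.
have HH0 : 0 < harmonic_sum N ^+ 2 :> R by rewrite exprn_gt0//; lra.
rewrite ler_pdivlMr; last by apply: mulr_gt0.
apply: (@le_trans _ _ (expR M * (8 * (4 * expR l ^+ 2)))).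
  by rewrite ler_pM2l ?expR_gt0// ler_pM2l.
apply: (@le_trans _ _ (t ^+ 2 * (Y / 2))); last by rewrite ler_wpM2l ?sqr_ge0.
(* The factor 256 is [8 * 4] from the denominator times 8 from
   [t^2 * (Y / 2) = expR (- W)^2 * Y / 8]. *)
have : expR M * expR l ^+ 2 * (4 * 4 * (4 * 4)) <= expR (- W) ^+ 2 * Y.
  apply: (@le_trans _ _ (expR M * expR l ^+ 2 * (expR 3 * expR 3 * (expR 3 * expR 3)))).
    by rewrite ler_pM2l ?mulr_gt0 ?exprn_gt0 ?expR_gt0// !ler_pM ?mulr_ge0.
  by rewrite !expr2 -!expRD ler_expR /W; lra.
rewrite /t exprMn; lra.
Qed.
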